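(* Let $n\geq 2$ be an integer. The first-order theory of the unary expansion class of $(\mathbb{R}^n,\beta)$ is $\Pi^1_1$-hard.
   Context: $\beta$ is the Euclidean betweenness relation on $\mathbb{R}^n$: $\beta(s,t,u)$ iff $d(s,u)=d(s,t)+d(t,u)$. The unary expansion class of $(\mathbb{R}^n,\beta)$ is the class of all structures $(\mathbb{R}^n,\beta,P)$ with $P\subseteq\mathbb{R}^n$; its first-order theory is the set of first-order $\{\beta,P\}$-sentences true in all these structures. Hardness is with respect to computable many-one reductions. *)

(* Defs.v *)
From mathcomp Require Import all_boot all_order all_algebra.
From mathcomp Require Import boolp classical_sets reals.

Set Implicit Arguments.
Unset Strict Implicit.
Unset Printing Implicit Defensive.

Import Order.TTheory GRing.Theory Num.Theory.

Local Open Scope classical_set_scope.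

(* First-order formulas over atomic formulas in [A], with variables named by
   natural numbers.  Negation, conjunction and existential quantification fo_form
   a complete set of connectives for the classical semantics [sat]. *)
Inductive fo_form (A : Type) : Type :=
| Atom of A
| Neg of fo_form A
| And of fo_form A & fo_form A
| Ex of nat & fo_form A.

Definition upd (D : Type) (s : nat -> D) (x : nat) (d : D) : nat -> D :=
  fun y => if y == x then d else s y.

Fixpoint sat (A D : Type) (holds : (nat -> D) -> A -> Prop)
    (s : nat -> D) (phi : fo_form A) : Prop :=
  match phi with
  | Atom a => holds s a
  | Neg phi1 => ~ sat holds s phi1
  | And phi1 phi2 => sat holds s phi1 /\ sat holds s phi2
  | Ex x phi1 => exists d : D, sat holds (upd s x d) phi1
  end.

Fixpoint fv (A : Type) (vars : A -> seq nat) (phi : fo_form A) : seq nat :=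
  match phi with
  | Atom a => vars a
  | Neg phi1 => fv vars phi1
  | And phi1 phi2 => fv vars phi1 ++ fv vars phi2
  | Ex x phi1 => [seq y <- fv vars phi1 | y != x]
  end.

Inductive geo_atom : Type :=
| GEq of nat & nat
| GBet of nat & nat & nat
| GPred of nat.

Definition geo_vars (a : geo_atom) : seq nat :=
  match a with
  | GEq x y => [:: x; y]
  | GBet x y z => [:: x; y; z]
  | GPred x => [:: x]
  end.

Definition sentence (phi : fo_form geo_atom) : Prop := fv geo_vars phi = [::].

Record geo_struct : Type := GeoStruct {
  carrier :> Type;
  bet : carrier -> carrier -> carrier -> Prop;
  upred : set carrier }.

Definition geo_holds (M : geo_struct) (s : nat -> M) (a : geo_atom) : Prop :=
  match a with
  | GEq x y => s x = s y
  | GBet x y z => bet (s x) (s y) (s z)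
  | GPred x => upred (s x)
  end.

(* Only used for sentences and structures with nonempty domain, for which the
   choice of the assignment is irrelevant. *)
Definition models (M : geo_struct) (phi : fo_form geo_atom) : Prop :=
  forall s : nat -> M, sat (@geo_holds M) s phi.

Definition fo_theory (C : geo_struct -> Prop) : set (fo_form geo_atom) :=
  [set phi | sentence phi /\ forall M, C M -> models M phi].

(* The norm that the library puts on row vectors is the sup norm, hence an
   explicit Euclidean distance. *)
Definition eucl_dist (R : realType) (n : nat) (s t : 'rV[R]_n) : R :=
  Num.sqrt (\sum_(i < n) (s ord0 i - t ord0 i) ^+ 2)%R.

Definition eucl_bet (R : realType) (n : nat) (s t u : 'rV[R]_n) : Prop :=
  eucl_dist s u = (eucl_dist s t + eucl_dist t u)%R.

Definition unary_expansion_class (R : realType) (n : nat)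
    (M : geo_struct) : Prop :=
  exists P : set 'rV[R]_n, M = @GeoStruct 'rV[R]_n (@eucl_bet R n) P.

(* Cantor pairing *)
Definition cpair (x y : nat) : nat := (((x + y) * (x + y).+1)./2 + y)%N.

Fixpoint godel (phi : fo_form geo_atom) : nat :=
  match phi with
  | Atom (GEq x y) => cpair 0 (cpair x y)
  | Atom (GBet x y z) => cpair 1 (cpair x (cpair y z))
  | Atom (GPred x) => cpair 2 x
  | Neg phi1 => cpair 3 (godel phi1)
  | And phi1 phi2 => cpair 4 (cpair (godel phi1) (godel phi2))
  | Ex x phi1 => cpair 5 (cpair x (godel phi1))
  end.

Lemma cpair_inj (x y x' y' : nat) :
  cpair x y = cpair x' y' -> x = x' /\ y = y'.
Proof.
have tS k : ((k.+1 * k.+2)./2 = (k * k.+1)./2 + k.+1)%N.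
  by rewrite -addn2 mulnDr halfD muln2 odd_double andbF add0n doubleK
     [(k.+1 * k)%N]mulnC.
have tmono k l : (k <= l)%N -> ((k * k.+1)./2 <= (l * l.+1)./2)%N.
  by move=> kl; apply: half_leq; apply: leq_mul.
have aux a b a' b' : (a + b < a' + b')%N -> (cpair a b < cpair a' b')%N.
  move=> /tmono; rewrite tS /cpair => h.
  apply: leq_trans (leq_addr _ _); apply: leq_trans h.
  by rewrite -addnS leq_add2l ltnS leq_addl.
move=> e; case: (ltngtP (x + y) (x' + y'))%N => h.
- by have := aux _ _ _ _ h; rewrite e ltnn.
- by have := aux _ _ _ _ h; rewrite e ltnn.
move: e; rewrite /cpair h => /addnI yy'; split=> //.
by apply: (@addIn y); rewrite h yy'.
Qed.

Lemma godel_inj : injective godel.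
Proof.
elim=> [[x y|x y z|x]|p IH|p IHp q IHq|x p IH]
       [[x' y'|x' y' z'|x']|p'|p' q'|x' p'] //= /cpair_inj [] // _.
- by move=> /cpair_inj[-> ->].
- by move=> /cpair_inj[-> /cpair_inj[-> ->]].
- by move=> ->.
- by move=> /IH ->.
- by move=> /cpair_inj[/IHp -> /IHq ->].
- by move=> /cpair_inj[-> /IH ->].
Qed.

Inductive murec : nat -> Type :=
| MZero n : murec n
| MSucc : murec 1
| MProj n (i : 'I_n) : murec n
| MComp k n (f : murec k) (g : 'I_k -> murec n) : murec n
| MPrec n (f : murec n) (g : murec n.+2) : murec n.+1
| MMin n (f : murec n.+1) : murec n.

(* [meval f v y]: the partial function [f] is defined at [v] with value [y].
   In primitive recursion the recursion argument comes first and [h i] is the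
   value after [i] steps; in minimization the searched argument comes first. *)
Fixpoint meval (n : nat) (f : murec n) : n.-tuple nat -> nat -> Prop :=
  match f in murec n return n.-tuple nat -> nat -> Prop with
  | MZero _ => fun v y => y = 0%N
  | MSucc => fun v y => y = (thead v).+1
  | MProj _ i => fun v y => y = tnth v i
  | MComp k _ f g => fun v y =>
      exists2 w : k.-tuple nat,
        forall i, meval (g i) v (tnth w i) & meval f w y
  | MPrec _ f g => fun v y =>
      exists h : nat -> nat,
        [/\ meval f (behead_tuple v) (h 0%N),
            forall i, (i < thead v)%N ->
              meval g (cons_tuple i (cons_tuple (h i) (behead_tuple v)))
                (h i.+1)
          & y = h (thead v)]
  | MMin _ f => fun v y =>
      meval f (cons_tuple y v) 0 /\
      forall i, (i < y)%N -> exists z, meval f (cons_tuple i v) z.+1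
  end.

Lemma meval_fun (n : nat) (f : murec n) (v : n.-tuple nat) (y y' : nat) :
  meval f v y -> meval f v y' -> y = y'.
Proof.
elim: f v y y' => {n} /= [n|| n i|k n f IHf g IHg|n f IHf g IHg|n f IHf] v y y'.
- by move=> -> ->.
- by move=> -> ->.
- by move=> -> ->.
- move=> [w gw fw] [w' gw' fw'].
  have ww' : w = w' by apply: eq_from_tnth => i; exact: IHg (gw i) (gw' i).
  by subst w'; exact: IHf fw fw'.
- move=> [h [h0 hS ->]] [h' [h'0 h'S ->]].
  suff H i : (i <= thead v)%N -> h i = h' i by exact: H.
  elim: i => [_|i IHi lti]; first exact: IHf h0 h'0.
  have := h'S _ lti; rewrite -(IHi (ltnW lti)); exact: IHg (hS _ lti).
- move=> [fy ly] [fy' ly']; case: (ltngtP y y') => // lt.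
  + by have [z /IHf /(_ fy)] := ly' _ lt.
  + by have [z /IHf /(_ fy')] := ly _ lt.
Qed.

Definition computable (f : nat -> nat) : Prop :=
  exists e : murec 1, forall x, meval e [tuple x] (f x).

Definition many_one_reducible (A B : set nat) : Prop :=
  exists2 f : nat -> nat, computable f & forall x, A x <-> B (f x).

Inductive arith_term : Type :=
| TVar of nat
| TZero
| TOne
| TAdd of arith_term & arith_term
| TMul of arith_term & arith_term.

(* [AMem t k] is the atomic formula [t \in X_k], with [X_k] the k-th set
   variable.  There are no set quantifiers, so that [fo_form arith_atom] is the
   set of arithmetical formulas of second-order arithmetic. *)
Inductive arith_atom : Type :=
| AEq of arith_term & arith_term
| ALt of arith_term & arith_term
| AMem of arith_term & nat.

Fixpoint term_vars (t : arith_term) : seq nat :=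
  match t with
  | TVar x => [:: x]
  | TZero | TOne => [::]
  | TAdd t u | TMul t u => term_vars t ++ term_vars u
  end.

Definition arith_vars (a : arith_atom) : seq nat :=
  match a with
  | AEq t u | ALt t u => term_vars t ++ term_vars u
  | AMem t _ => term_vars t
  end.

Fixpoint term_val (s : nat -> nat) (t : arith_term) : nat :=
  match t with
  | TVar x => s x
  | TZero => 0
  | TOne => 1
  | TAdd t u => term_val s t + term_val s u
  | TMul t u => term_val s t * term_val s u
  end.

Definition arith_holds (X : nat -> set nat) (s : nat -> nat) (a : arith_atom) :
    Prop :=
  match a with
  | AEq t u => term_val s t = term_val s u
  | ALt t u => (term_val s t < term_val s u)%N
  | AMem t k => X k (term_val s t)
  end.

(* Lightface: [A] is defined by [forall X_0 ... X_k, phi] where [phi] is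
   arithmetical, has no number variable other than [x_0] free, and contains no
   set parameters, as all the (finitely many) set variables occurring in [phi]
   are quantified. *)
Definition Pi11 (A : set nat) : Prop :=
  exists2 phi : fo_form arith_atom,
    forall x, x \in fv arith_vars phi -> x = 0%N
    & forall m, A m <->
        forall X : nat -> set nat, sat (arith_holds X) (fun=> m) phi.

Definition Pi11_hard (B : set nat) : Prop :=
  forall A : set nat, Pi11 A -> many_one_reducible A B.

(* Main.v *)
(* The numbers are coded by a set of P-points of order type omega on a ray. That
   it has this order type is a first-order condition, because the ray is order
   complete: every number has a next one, and there is no accumulation point.
   A P-point strictly between a point of a second ray and a point of the first
   one codes an arbitrary binary relation between the P-points of the two rays,
   hence, by blocks of consecutive points of the second ray, arbitrary relations
   on the numbers. Requiring two of these to obey the recursion equations of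
   addition and multiplication pins them down, while the other ones are free and
   play the role of the set variables of a Pi^1_1 formula: truth in all
   expansions is truth for all values of the set variables. *)

Require Import Defs.
From mathcomp Require Import all_boot all_order all_algebra zify ring lra.
From mathcomp Require Import boolp classical_sets reals.

Set Implicit Arguments.
Unset Strict Implicit.
Unset Printing Implicit Defensive.

Import Order.TTheory GRing.Theory Num.Theory.

Local Open Scope classical_set_scope.

(** * Formulas and definability *)

Section Formulas.
Variables (A D : Type) (vars : A -> seq nat) (holds : (nat -> D) -> A -> Prop).
Hypothesis holds_ext : forall s s' a,
  {in vars a, s =1 s'} -> holds s a <-> holds s' a.

Lemma sat_ext (phi : fo_form A) s s' :
  {in fv vars phi, s =1 s'} -> sat holds s phi <-> sat holds s' phi.
Proof.
elim: phi s s' => [a|p IH|p IHp q IHq|x p IH] s s' /= ss'.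
- exact: holds_ext.
- by rewrite (IH _ _ ss').
- rewrite (IHp s s') ?(IHq s s') // => y y_in; apply: ss';
    by rewrite mem_cat y_in ?orbT.
- have H d : sat holds (upd s x d) p <-> sat holds (upd s' x d) p.
    apply: IH => y y_in; rewrite /upd; case: eqP => // /eqP yx.
    by apply: ss'; rewrite mem_filter yx.
  by split=> -[d /H]; exists d.
Qed.

Definition all_form x (phi : fo_form A) := Neg (Ex x (Neg phi)).

Definition all_closure (l : seq nat) (phi : fo_form A) := foldr all_form phi l.

Lemma fv_all_closure l phi :
  fv vars (all_closure l phi) = [seq y <- fv vars phi | y \notin l].
Proof.
elim: l => [|x l IH] /=; first by rewrite filter_predT.
rewrite IH -filter_predI; apply: eq_filter => y /=.
by rewrite inE negb_or.
Qed.

(** Truth under all assignments absorbs any universal prefix, whether or not [l] lists the free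
    variables: [s] is its own update at [x] by [s x]. *)
Lemma sat_all_closure l phi :
  (forall s, sat holds s (all_closure l phi)) <-> (forall s, sat holds s phi).
Proof.
elim: l => [//|x l IH] /=; rewrite -IH; split=> [H s|H s [d]]; last exact.
apply: contrapT => nH; apply: (H s); exists (s x).
suff -> : upd s x (s x) = s by [].
by apply: funext => y; rewrite /upd; case: eqP => // ->.
Qed.

End Formulas.

(** Capture is avoided by a bound variable [z] larger than the images of all free variables of the
    body. *)
Fixpoint rename (f : nat -> nat) (phi : fo_form geo_atom) : fo_form geo_atom :=
  match phi with
  | Atom (GEq x y) => Atom (GEq (f x) (f y))
  | Atom (GBet x y z) => Atom (GBet (f x) (f y) (f z))
  | Atom (GPred x) => Atom (GPred (f x))
  | Neg p => Neg (rename f p)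
  | And p q => And (rename f p) (rename f q)
  | Ex x p =>
      let z := (\max_(y <- fv geo_vars p) f y).+1 in
      Ex z (rename (upd f x z) p)
  end.

Lemma geo_holds_ext (M : geo_struct) (s s' : nat -> M) a :
  {in geo_vars a, s =1 s'} -> geo_holds s a <-> geo_holds s' a.
Proof.
by case: a => [x y|x y z|x] /= ss'; rewrite !ss' ?inE ?eqxx ?orbT.
Qed.

Lemma sat_rename (M : geo_struct) f phi (s : nat -> M) :
  sat (@geo_holds M) s (rename f phi) <->
  sat (@geo_holds M) (fun x => s (f x)) phi.
Proof.
elim: phi f s => [[x y|x y z|x]|p IH|p IHp q IHq|x p IH] f s //=.
- by rewrite IH.
- by rewrite IHp IHq.
set z := (\max_(y <- _) _).+1.
have H d : sat (@geo_holds M) (upd s z d) (rename (upd f x z) p) <->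
           sat (@geo_holds M) (upd (fun x => s (f x)) x d) p.
  rewrite IH; apply: (sat_ext (@geo_holds_ext M)) => y y_in.
  rewrite /upd; case: (y == x); first by rewrite eqxx.
  rewrite ifN // neq_ltn ltnS; apply/orP; left.
  exact: leq_bigmax_seq.
by split=> -[d /H]; exists d.
Qed.

Section Definability.
Variables (D : Type) (bt : D -> D -> D -> Prop).

Definition shift (s : nat -> D) : nat -> D := fun x => s x.+1.

(* The formula is not allowed to depend on P. *)
Definition definable (Q : set D -> (nat -> D) -> Prop) : Prop :=
  exists phi, forall P s, sat (@geo_holds (GeoStruct bt P)) s phi <-> Q P s.

Lemma def_ext (Q Q' : set D -> (nat -> D) -> Prop) :
  (forall P s, Q' P s <-> Q P s) -> definable Q -> definable Q'.
Proof. by move=> QQ' [phi H]; exists phi => P s; rewrite QQ'. Qed.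

Lemma def_eq i j : definable (fun _ s => s i = s j).
Proof. by exists (Atom (GEq i j)). Qed.

Lemma def_bet i j k : definable (fun _ s => bt (s i) (s j) (s k)).
Proof. by exists (Atom (GBet i j k)). Qed.

Lemma def_pred i : definable (fun P s => P (s i)).
Proof. by exists (Atom (GPred i)). Qed.

Lemma def_not (Q : set D -> (nat -> D) -> Prop) :
  definable Q -> definable (fun P s => ~ Q P s).
Proof. by move=> [p H]; exists (Neg p) => P s /=; rewrite H. Qed.

Lemma def_and (Q Q' : set D -> (nat -> D) -> Prop) :
  definable Q -> definable Q' -> definable (fun P s => Q P s /\ Q' P s).
Proof.
by move=> [p H] [p' H']; exists (And p p') => P s /=; rewrite H H'.
Qed.

Lemma def_imp (Q Q' : set D -> (nat -> D) -> Prop) :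
  definable Q -> definable Q' -> definable (fun P s => Q P s -> Q' P s).
Proof.
move=> dQ dQ'; apply: def_ext (def_not (def_and dQ (def_not dQ'))) => P s.
split; first by move=> h [/h].
by move=> h q; apply: contrapT => nq; apply: h.
Qed.

Lemma def_or (Q Q' : set D -> (nat -> D) -> Prop) :
  definable Q -> definable Q' -> definable (fun P s => Q P s \/ Q' P s).
Proof.
move=> dQ dQ'; apply: def_ext (def_imp (def_not dQ) dQ') => P s.
split; first by case.
by move=> h; case: (pselect (Q P s)) => [|/h]; [left|right].
Qed.

Lemma def_iff (Q Q' : set D -> (nat -> D) -> Prop) :
  definable Q -> definable Q' -> definable (fun P s => Q P s <-> Q' P s).
Proof. by move=> dQ dQ'; apply: def_and; apply: def_imp. Qed.

Lemma def_rename (f : nat -> nat) (Q : set D -> (nat -> D) -> Prop) :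
  definable Q -> definable (fun P s => Q P (fun x => s (f x))).
Proof. by move=> [p H]; exists (rename f p) => P s; rewrite sat_rename H. Qed.

(** De Bruijn style: the quantified point gets index 0 and all other indices move up by one. The
    formula binds variable 0, and renaming by [predn] undoes the shift. Definability then follows
    from the shape of a predicate, with no choice of variable names. *)
Lemma def_ex (Q : set D -> D -> (nat -> D) -> Prop) :
  definable (fun P s => Q P (s 0) (shift s)) ->
  definable (fun P s => exists d, Q P d s).
Proof.
move=> [p H].
have : definable (fun P s => exists d, Q P d (shift (upd s 0 d))).
  exists (Ex 0 p) => P s /=.
  by split=> -[d /H h]; exists d.
move=> /(def_rename predn); apply: def_ext => P s.
have e d : shift (upd (fun x => s x.-1) 0 d) = s by apply: funext.
by split=> -[d]; rewrite ?e => ?; exists d; rewrite ?e.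
Qed.

Lemma def_all (Q : set D -> D -> (nat -> D) -> Prop) :
  definable (fun P s => Q P (s 0) (shift s)) ->
  definable (fun P s => forall d, Q P d s).
Proof.
move=> /def_not/(@def_ex (fun P d s => ~ Q P d s))/def_not.
apply: def_ext => P s; split; first by move=> h [d]; apply.
by move=> h d; apply: contrapT => nq; apply: h; exists d.
Qed.

End Definability.

(** * Computability *)

Definition computes n (f : n.-tuple nat -> nat) : Prop :=
  exists e : murec n, forall v, meval e v (f v).

Lemma computes_ext n (f f' : n.-tuple nat -> nat) :
  f =1 f' -> computes f -> computes f'.
Proof. by move=> ff' [e He]; exists e => v; rewrite -ff'. Qed.

Lemma computes_proj n (i : 'I_n) : computes (fun v => tnth v i).
Proof. by exists (MProj i). Qed.

Lemma computes_comp k n (f : k.-tuple nat -> nat)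
    (g : 'I_k -> n.-tuple nat -> nat) :
  computes f -> (forall i, computes (g i)) ->
  computes (fun v => f [tuple g i v | i < k]).
Proof.
move=> [e He] /choice[d Hd]; exists (MComp e d) => v /=.
by exists [tuple g i v | i < k] => // i; rewrite tnth_mktuple.
Qed.

Lemma computes_comp1 n (f : nat -> nat) (g : n.-tuple nat -> nat) :
  computes (fun v : 1.-tuple nat => f (thead v)) -> computes g ->
  computes (fun v => f (g v)).
Proof.
move=> cf cg; apply: computes_ext (computes_comp (g := fun=> g) cf _) => // v.
by rewrite /thead tnth_mktuple.
Qed.

Lemma computes_comp2 n (f : nat -> nat -> nat) (g h : n.-tuple nat -> nat) :
  computes (fun v : 2.-tuple nat => f (tnth v ord0) (tnth v ord_max)) ->
  computes g -> computes h -> computes (fun v => f (g v) (h v)).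
Proof.
move=> cf cg ch.
apply: computes_ext
  (computes_comp (g := fun i => if i == ord0 then g else h) cf _).
  by move=> v; rewrite !tnth_mktuple.
by move=> i; case: ifP.
Qed.

Lemma computes_succ n (g : n.-tuple nat -> nat) :
  computes g -> computes (fun v => (g v).+1).
Proof. by apply: computes_comp1; exists MSucc. Qed.

Lemma computes_cst n c : computes (fun _ : n.-tuple nat => c).
Proof.
by elim: c => [|c IH]; [exists (MZero n)|apply: computes_succ].
Qed.

Lemma computes_rec n (h : nat -> n.-tuple nat -> nat)
    (g : n.+2.-tuple nat -> nat) :
  computes (h 0) -> computes g ->
  (forall i v, h i.+1 v = g (cons_tuple i (cons_tuple (h i v) v))) ->
  computes (fun v : n.+1.-tuple nat => h (thead v) (behead_tuple v)).
Proof.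
move=> [e He] [d Hd] hS; exists (MPrec e d) => v /=.
exists (fun i => h i (behead_tuple v)); split=> // i _.
by rewrite hS; exact: Hd.
Qed.

Lemma computes_add n (g h : n.-tuple nat -> nat) :
  computes g -> computes h -> computes (fun v => g v + h v).
Proof.
apply: computes_comp2.
pose f i (v : 1.-tuple nat) := i + thead v.
have : computes (fun v : 2.-tuple nat => f (thead v) (behead_tuple v)).
  (* Recursion is on the first summand; entry 1 of the argument tuple is the previous value. *)
  apply: (computes_rec (h := f) (g := fun v => (tnth v (inord 1)).+1)).
  - exact: (computes_proj ord0).
  - exact/computes_succ/computes_proj.
  - by move=> i v; rewrite (tnth_nth 0) inordK.
apply: computes_ext => v; rewrite /f /thead tnth_behead; congr (_ + tnth v _).
by apply/val_inj; rewrite /= inordK.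
Qed.

Lemma computes_iter (f : nat -> nat) c :
  computes (fun v : 1.-tuple nat => f (thead v)) ->
  computes (fun v : 1.-tuple nat => iter (thead v) f c).
Proof.
move=> cf; pose h i (_ : 0.-tuple nat) := iter i f c.
apply: (computes_rec (h := h) (g := fun v => f (tnth v (inord 1)))).
- exact: computes_cst.
- exact/(computes_comp1 cf)/computes_proj.
- by move=> i v; rewrite (tnth_nth 0) inordK.
Qed.

(** This recursion makes Cantor pairing computable without a program for halving. *)
Lemma triangleS k : (k.+1 * k.+2)./2 = (k * k.+1)./2 + k.+1.
Proof.
by rewrite -addn2 mulnDr halfD muln2 odd_double andbF add0n doubleK
   [k.+1 * k]mulnC.
Qed.

Lemma computes_triangle n (g : n.-tuple nat -> nat) :
  computes g -> computes (fun v => (g v * (g v).+1)./2).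
Proof.
apply: (@computes_comp1 _ (fun k => (k * k.+1)./2)).
pose h i (_ : 0.-tuple nat) := (i * i.+1)./2.
apply: (computes_rec (h := h)
  (g := fun v => tnth v (inord 1) + (tnth v (inord 0)).+1)).
- exact: computes_cst.
- by apply: computes_add; [|apply: computes_succ]; apply: computes_proj.
- by move=> i v; rewrite /h triangleS !(tnth_nth 0) !inordK.
Qed.

Lemma computes_cpair n (g h : n.-tuple nat -> nat) :
  computes g -> computes h -> computes (fun v => cpair (g v) (h v)).
Proof.
move=> cg ch; apply: computes_add => //.
exact/computes_triangle/computes_add.
Qed.

Lemma computable_computes (f : nat -> nat) :
  computes (fun v : 1.-tuple nat => f (thead v)) -> computable f.
Proof.
by move=> [e He]; exists e => x; have := He [tuple x]; rewrite theadE.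
Qed.

(** * Coding arithmetic by a unary predicate *)

Section Coding.
Variables (D : Type) (bt : D -> D -> D -> Prop).

(** The point [a] is the number zero, and the numbers go on from there, away from [o]. With [b] in
    place of [a] the same predicate gives the rows of the code. *)
Definition numb (P : set D) (o a p : D) : Prop := P p /\ bt o a p.

Definition succ (P : set D) (o a p q : D) : Prop :=
  numb P o a p /\ numb P o a q /\ p <> q /\ bt o p q /\
  forall r, numb P o a r -> bt p r q -> r = p \/ r = q.

Definition linked (P : set D) (t p : D) : Prop :=
  exists c, P c /\ c <> t /\ c <> p /\ bt t c p.

(* Five consecutive points of the second axis, the first of which is linked to
   no number, code the quadruples of numbers linked to the last four of them. *)
Definition coded (P : set D) (o a b i j k l : D) : Prop :=
  exists t0 t1 t2 t3 t4,
    succ P o b t0 t1 /\ succ P o b t1 t2 /\ succ P o b t2 t3 /\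
    succ P o b t3 t4 /\ (forall p, numb P o a p -> ~ linked P t0 p) /\
    linked P t1 i /\ linked P t2 j /\ linked P t3 k /\ linked P t4 l.

(* The last clause forbids accumulation points of the numbers. *)
Definition omega_type (P : set D) (o a : D) : Prop :=
  P a /\ o <> a /\
  (forall p, numb P o a p -> exists q, succ P o a p q) /\
  (forall x, bt o a x -> x <> a ->
     exists y, bt a y x /\ y <> x /\
       forall r, numb P o a r -> bt y r x -> r = y \/ r = x).

Definition add (P : set D) (o a b x y z : D) : Prop := coded P o a b a x y z.

Definition mul (P : set D) (o a b x y z : D) : Prop :=
  exists t, succ P o a a t /\ coded P o a b t x y z.

(** The clauses are equivalences, so they settle negative instances too. The witness [w] must be a
    number: [succ] ensures this for addition, while for multiplication it is demanded, as rows may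
    be linked to points that are not numbers. *)
Definition recursion_axioms (P : set D) (o a b : D) : Prop :=
  (forall x z, numb P o a x -> numb P o a z ->
     (add P o a b x a z <-> z = x)) /\
  (forall x y y' z, numb P o a x -> succ P o a y y' -> numb P o a z ->
     (add P o a b x y' z <-> exists w, add P o a b x y w /\ succ P o a w z)) /\
  (forall x z, numb P o a x -> numb P o a z ->
     (mul P o a b x a z <-> z = a)) /\
  (forall x y y' z, numb P o a x -> succ P o a y y' -> numb P o a z ->
     (mul P o a b x y' z <->
      exists w, numb P o a w /\ mul P o a b x y w /\ add P o a b w x z)).

Definition codes_arith (P : set D) (o a b : D) : Prop :=
  omega_type P o a /\ recursion_axioms P o a b.

Fixpoint num (P : set D) (o a : D) (m : nat) (p : D) : Prop :=
  if m is m'.+1 then exists q, num P o a m' q /\ succ P o a q p else p = a.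

(* The tags 0 and 1 of the coded quadruples are used for addition and
   multiplication. *)
Definition member (P : set D) (o a b : D) (k : nat) (x : D) : Prop :=
  exists t, num P o a k.+2 t /\ coded P o a b t x x x.

(** Evaluation is given by its graph, the language having no function symbols. Compound terms carry
    [numb] because a coded quadruple may contain points other than numbers. *)
Fixpoint tval (P : set D) (o a b : D) (e : nat -> D) (t : arith_term) (z : D) :
    Prop :=
  match t with
  | TVar x => z = e x
  | TZero => z = a
  | TOne => succ P o a a z
  | TAdd t u => numb P o a z /\ exists x y,
      tval P o a b e t x /\ tval P o a b e u y /\ add P o a b x y z
  | TMul t u => numb P o a z /\ exists x y,
      tval P o a b e t x /\ tval P o a b e u y /\ mul P o a b x y z
  end.

Definition trans_atom (P : set D) (o a b : D) (e : nat -> D) (f : arith_atom) :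
    Prop :=
  match f with
  | AEq t u => exists x, tval P o a b e t x /\ tval P o a b e u x
  | ALt t u => exists x y,
      tval P o a b e t x /\ tval P o a b e u y /\ x <> y /\ bt o x y
  | AMem t k => exists x, tval P o a b e t x /\ member P o a b k x
  end.

(** Number quantifiers are relativized to the coded numbers; set variables are never quantified and
    are read off from [P] through [member]. *)
Fixpoint trans (P : set D) (o a b : D) (e : nat -> D)
    (phi : fo_form arith_atom) : Prop :=
  match phi with
  | Atom f => trans_atom P o a b e f
  | Neg p => ~ trans P o a b e p
  | And p q => trans P o a b e p /\ trans P o a b e q
  | Ex x p => exists d, numb P o a d /\ trans P o a b (upd e x d) p
  end.

Ltac def_atom := first [ apply: def_eq | apply: def_bet | apply: def_pred ].
Ltac def_step :=
  first [ def_atom | apply: def_iff | apply: def_not | apply: def_and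
        | apply: def_or | apply: def_ex | apply: def_imp | apply: def_all ].
Ltac def_auto := repeat (cbn beta delta [shift]; def_step).

Lemma def_numb i j k : definable bt (fun P s => numb P (s i) (s j) (s k)).
Proof. by rewrite /numb; def_auto. Qed.

Lemma def_succ i j k l :
  definable bt (fun P s => succ P (s i) (s j) (s k) (s l)).
Proof. by rewrite /succ /numb; def_auto. Qed.

Lemma def_linked i j : definable bt (fun P s => linked P (s i) (s j)).
Proof. by rewrite /linked; def_auto. Qed.

Ltac def_atom ::=
  first [ apply: def_eq | apply: def_bet | apply: def_pred | apply: def_numb
        | apply: def_succ | apply: def_linked ].

Lemma def_coded o a b i j k l : definable bt (fun P s =>
  coded P (s o) (s a) (s b) (s i) (s j) (s k) (s l)).
Proof. by rewrite /coded; def_auto. Qed.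

Ltac def_atom ::=
  first [ apply: def_eq | apply: def_bet | apply: def_pred | apply: def_numb
        | apply: def_succ | apply: def_linked | apply: def_coded ].

Lemma def_codes_arith o a b :
  definable bt (fun P s => codes_arith P (s o) (s a) (s b)).
Proof.
by rewrite /codes_arith /omega_type /recursion_axioms /mul /add; def_auto.
Qed.

Lemma def_num m o a i : definable bt (fun P s => num P (s o) (s a) m (s i)).
Proof.
elim: m o a i => [|m IH] o a i /=; first by def_auto.
by apply: def_ex; cbn beta delta [shift]; apply: def_and; [apply: IH|def_auto].
Qed.

Lemma def_member k o a b i :
  definable bt (fun P s => member P (s o) (s a) (s b) k (s i)).
Proof.
apply: def_ex; cbn beta delta [shift].
by apply: def_and; [apply: def_num|def_auto].
Qed.

(** The environment is described by the variables holding its values; each quantifier passed raises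
    the index map [f] by one. *)
Lemma def_tval t o a b (f : nat -> nat) i : definable bt (fun P s =>
  tval P (s o) (s a) (s b) (fun x => s (f x)) t (s i)).
Proof.
have H t1 t2 (IH1 : forall o a b (f : nat -> nat) i, definable bt (fun P s =>
      tval P (s o) (s a) (s b) (fun x => s (f x)) t1 (s i)))
    (IH2 : forall o a b (f : nat -> nat) i, definable bt (fun P s =>
      tval P (s o) (s a) (s b) (fun x => s (f x)) t2 (s i)))
    (R : set D -> D -> D -> D -> D -> D -> D -> Prop)
    (dR : forall o a b i j k, definable bt (fun P s =>
      R P (s o) (s a) (s b) (s i) (s j) (s k))) o' a' b' f' i' :
    definable bt (fun P s => numb P (s o') (s a') (s i') /\ exists x y,
      tval P (s o') (s a') (s b') (fun x => s (f' x)) t1 x /\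
      tval P (s o') (s a') (s b') (fun x => s (f' x)) t2 y /\
      R P (s o') (s a') (s b') x y (s i')).
  apply: def_and; first exact: def_numb.
  do 2 apply: def_ex; cbn beta delta [shift].
  apply: def_and; first by apply: (IH1 _ _ _ (fun x => (f' x).+2)).
  by apply: def_and; [apply: (IH2 _ _ _ (fun x => (f' x).+2))|apply: dR].
elim: t o a b f i => [x|||t1 IH1 t2 IH2|t1 IH1 t2 IH2] o a b f i /=.
- exact: (def_eq bt i (f x)).
- exact: def_eq.
- exact: def_succ.
- by apply: (H t1 t2 IH1 IH2 add) => *; apply: def_coded.
- by apply: (H t1 t2 IH1 IH2 mul) => *; rewrite /mul; def_auto.
Qed.

Lemma def_trans phi o a b (f : nat -> nat) : definable bt (fun P s =>
  trans P (s o) (s a) (s b) (fun x => s (f x)) phi).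
Proof.
elim: phi o a b f => [[t u|t u|t k]|p IH|p IHp q IHq|x p IH] o a b f /=.
- apply: def_ex; cbn beta delta [shift].
  by apply: def_and; apply: (def_tval _ _ _ _ (fun x => (f x).+1)).
- do 2 apply: def_ex; cbn beta delta [shift].
  apply: def_and; first by apply: (def_tval _ _ _ _ (fun x => (f x).+2)).
  apply: def_and; first by apply: (def_tval _ _ _ _ (fun x => (f x).+2)).
  by def_auto.
- apply: def_ex; cbn beta delta [shift].
  apply: def_and; first by apply: (def_tval _ _ _ _ (fun x => (f x).+1)).
  exact: def_member.
- exact/def_not/IH.
- by apply: def_and; [apply: IHp|apply: IHq].
- apply: def_ex; cbn beta delta [shift].
  apply: def_and; first exact: def_numb.
  (* The new point has index 0, so the index map sends [x] to 0 and is raised by one elsewhere. *)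
  apply: def_ext (IH o.+1 a.+1 b.+1 (upd (fun y => (f y).+1) x 0)) => P s.
  suff <- : upd (fun y => s (f y).+1) x (s 0) =
    (fun y => s (upd (fun y => (f y).+1) x 0 y)) by [].
  by apply: funext => y; rewrite /upd; case: (y == x).
Qed.

End Coding.

(** * Euclidean betweenness *)

Section Euclid.
Variables (R : realType) (n : nat).
Local Open Scope ring_scope.
Implicit Types (s t u o a x : 'rV[R]_n).

Definition dot (x y : 'rV[R]_n) : R := \sum_(i < n) x ord0 i * y ord0 i.

Lemma dotC x y : dot x y = dot y x.
Proof. by apply: eq_bigr => i _; rewrite mulrC. Qed.

Lemma dotDl x y z : dot (x + y) z = dot x z + dot y z.
Proof. by rewrite -big_split; apply: eq_bigr => i _ /=; rewrite mxE mulrDl. Qed.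

Lemma dotZl l x y : dot (l *: x) y = l * dot x y.
Proof. by rewrite mulr_sumr; apply: eq_bigr => i _; rewrite mxE mulrA. Qed.

Lemma dotDr x y z : dot z (x + y) = dot z x + dot z y.
Proof. by rewrite !(dotC z) dotDl. Qed.

Lemma dotZr l x y : dot y (l *: x) = l * dot y x.
Proof. by rewrite !(dotC y) dotZl. Qed.

Lemma dot_ge0 x : 0 <= dot x x.
Proof. by apply: sumr_ge0 => i _; rewrite -expr2 sqr_ge0. Qed.

Lemma dot_eq0 x : dot x x = 0 -> x = 0.
Proof.
move/eqP; rewrite psumr_eq0 => [/allP H|i _]; last by rewrite -expr2 sqr_ge0.
apply/rowP => i; rewrite mxE; apply/eqP.
by have := H i (mem_index_enum _); rewrite /= -expr2 sqrf_eq0.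
Qed.

Definition enorm x : R := Num.sqrt (dot x x).

Lemma enorm_ge0 x : 0 <= enorm x. Proof. exact: sqrtr_ge0. Qed.

Lemma enorm_sqr x : enorm x ^+ 2 = dot x x.
Proof. by rewrite sqr_sqrtr ?dot_ge0. Qed.

Lemma enormZ l x : 0 <= l -> enorm (l *: x) = l * enorm x.
Proof.
move=> l0; rewrite /enorm dotZl dotZr mulrA -expr2 sqrtrM ?sqr_ge0 //.
by rewrite sqrtr_sqr ger0_norm.
Qed.

Lemma eucl_dist_enorm s t : eucl_dist s t = enorm (t - s).
Proof.
congr (Num.sqrt _); apply: eq_bigr => i _.
by rewrite !mxE -expr2 -sqrrN opprB.
Qed.

(** Squaring the equality case of the triangle inequality gives [dot x y = enorm x * enorm y], and
    then the difference of the two sides has norm zero. *)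
Lemma enormD_eq x y :
  enorm (x + y) = enorm x + enorm y -> enorm y *: x = enorm x *: y.
Proof.
move=> e; have e2 : dot x y = enorm x * enorm y.
  have := congr1 (fun z => z ^+ 2) e; rewrite sqrrD !enorm_sqr.
  rewrite dotDl !dotDr (dotC y x); lra.
apply/eqP; rewrite -subr_eq0; apply/eqP/dot_eq0.
rewrite -scaleN1r !(dotDl, dotDr, dotZl, dotZr) (dotC y x) e2 -!enorm_sqr.
ring.
Qed.

(** The forward direction is the equality case for [t - s] and [u - t], with [l] the ratio of the
    distances from [s] to [t] and from [s] to [u]. *)
Lemma eucl_betP s t u :
  eucl_bet s t u <-> exists2 l, 0 <= l <= 1 & t = s + l *: (u - s).
Proof.
rewrite /eucl_bet !eucl_dist_enorm; split=> [e|[l /andP[l0 l1] ->]].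
  set x := t - s in e *; set y := u - t in e *.
  have xy : u - s = x + y by rewrite [x + y]addrC addrA subrK.
  rewrite xy in e *; have h := enormD_eq e.
  have x0 := enorm_ge0 x; have y0 := enorm_ge0 y.
  (* If the total length is zero, the ratio is meaningless; but then [t = s], and [l = 0] serves. *)
  have [d0|d0] := eqVneq (enorm x + enorm y) 0.
    exists 0; first by rewrite lexx ler01.
    have /eqP : enorm x = 0 by lra.
    rewrite sqrtr_eq0 => x_le; have /dot_eq0/subr0_eq -> : dot x x = 0.
      by apply/eqP; rewrite eq_le x_le dot_ge0.
    by rewrite scale0r addr0.
  have dp : 0 < enorm x + enorm y by rewrite lt_neqAle eq_sym d0 addr_ge0.
  exists (enorm x / (enorm x + enorm y)).
    by rewrite divr_ge0 ?(ltW dp) //= ler_pdivrMr // mul1r lerDl.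
  rewrite mulrC -scalerA scalerDr -h -scalerDl scalerA mulVf // scale1r.
  by rewrite /x [s + _]addrC subrK.
have -> : u - (s + l *: (u - s)) = (1 - l) *: (u - s).
  by rewrite scalerBl scale1r opprD addrA.
rewrite [s + _]addrC addrK !enormZ ?subr_ge0 //; ring.
Qed.

(** An affine coordinate on the line, 0 at [o] and 1 at [a], which turns betweenness into the order
    of [R]. *)
Definition ray o a (l : R) : 'rV[R]_n := o + l *: (a - o).

Lemma ray0 o a : ray o a 0 = o.
Proof. by rewrite /ray scale0r addr0. Qed.

Lemma ray1 o a : ray o a 1 = a.
Proof. by rewrite /ray scale1r addrC subrK. Qed.

Lemma ray_inj o a : o <> a -> injective (ray o a).
Proof.
move=> /eqP oa l m /addrI/eqP; rewrite -subr_eq0 -scalerBl scaler_eq0.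
by rewrite !subr_eq0 [a == o]eq_sym (negPf oa) orbF => /eqP.
Qed.

Lemma bet_ray o a l x r : l <= r ->
  eucl_bet (ray o a l) x (ray o a r) <->
  exists2 m, l <= m <= r & x = ray o a m.
Proof.
move=> lr; have e k : ray o a l + k *: (ray o a r - ray o a l) =
    ray o a (l + k * (r - l)).
  rewrite /ray opprD addrACA subrr add0r -scalerBl scalerA.
  by rewrite -addrA -scalerDl.
rewrite eucl_betP; split=> [[k /andP[k0 k1]]|[m /andP[lm mr] ->]].
  by rewrite e => ->; exists (l + k * (r - l)) => //; apply/andP; split; nra.
have [e0|ne] := eqVneq l r.
  exists 0; first by rewrite lexx ler01.
  by rewrite e mul0r addr0; congr ray; lra.
have d : 0 < r - l by rewrite subr_gt0 lt_neqAle ne.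
exists ((m - l) / (r - l)).
  by rewrite divr_ge0 ?(ltW d) ?subr_ge0 //= ler_pdivrMr // mul1r lerD2r.
by rewrite e divfK ?gt_eqF //; congr ray; lra.
Qed.

Lemma bet_ray_scalars o a l m r : o <> a -> l <= r ->
  eucl_bet (ray o a l) (ray o a m) (ray o a r) <-> l <= m <= r.
Proof.
move=> oa /bet_ray ->; split=> [[m' h /(ray_inj oa) ->] //|h].
by exists m.
Qed.

Lemma bet_beyond o a x : o <> a ->
  eucl_bet o a x <-> exists2 l, 1 <= l & x = ray o a l.
Proof.
move=> oa; split=> [/eucl_betP[l /andP[l0 l1] e]|[l l1 ->]].
  have ln0 : l != 0.
    by apply: contra_not_neq oa => z; rewrite e z scale0r addr0.
  (* As [a] is [l] of the way from [o] to [x], the coordinate of [x] is the inverse of [l]. *)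
  exists l^-1; first by rewrite invf_ge1 // lt_neqAle eq_sym ln0.
  have ao : a - o = l *: (x - o) by rewrite {1}e addrC addKr.
  by rewrite /ray ao scalerA mulVf // scale1r addrC subrK.
rewrite -{1}(ray0 o a) -{2}(ray1 o a) bet_ray_scalars //; last by lra.
by rewrite ler01.
Qed.

End Euclid.

(** * Decoding *)

Section Numbers.
Variables (R : realType) (n : nat) (P : set 'rV[R]_n) (o a b : 'rV[R]_n).
Local Notation bt := (@eucl_bet R n).
Local Notation numb := (numb bt P o a).
Local Notation succ := (succ bt P o a).
Local Notation num := (num bt P o a).
Local Notation ray := (ray o a).
Implicit Types (p q x y z w : 'rV[R]_n).
Hypothesis om : omega_type bt P o a.

Lemma o_neq_a : o <> a. Proof. by case: om => _ []. Qed.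

Lemma numb_ray p : numb p -> exists2 l, (1 <= l)%R & p = ray l.
Proof. by case=> _ /(bet_beyond _ o_neq_a). Qed.

Lemma bet_o_ray l m : (0 <= l)%R -> (0 <= m)%R ->
  bt o (ray l) (ray m) <-> (l <= m)%R.
Proof.
move=> l0 m0; rewrite -{1}(ray0 o a) bet_ray_scalars //; last exact: o_neq_a.
by rewrite l0.
Qed.

Lemma numb_a : numb a.
Proof.
case: om => Pa _; split=> //; apply/(bet_beyond _ o_neq_a).
by exists 1%R; rewrite ?ray1.
Qed.

Lemma succ_numbl p q : succ p q -> numb p. Proof. by case. Qed.

Lemma succ_numbr p q : succ p q -> numb q. Proof. by case=> _ []. Qed.

Lemma succ_ray l q : (0 <= l)%R -> succ (ray l) q ->
  exists2 m, (l < m)%R & q = ray m.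
Proof.
move=> l0 [_ [/numb_ray[m m1 ->] [ne [+ _]]]].
rewrite bet_o_ray //; last exact: le_trans m1.
move=> lm; exists m => //; rewrite lt_neqAle lm andbT.
by apply: contra_not_neq ne => ->.
Qed.

(** The nearer of two successors lies between [p] and the other one; by consecutiveness it equals
    the other. *)
Lemma succ_fun p q q' : succ p q -> succ p q' -> q = q'.
Proof.
move=> s s'; have /numb_ray[l l1 pE] := succ_numbl s; subst p.
have l0 := le_trans ler01 l1.
have [m lm qE] := succ_ray l0 s; have [m' lm' qE'] := succ_ray l0 s'.
subst q q'.
wlog mm' : m m' lm lm' s s' / (m <= m')%R.
  by case/orP: (le_total m m') => h H; [|apply: esym]; apply: H.
have [_ [_ [_ [_ /(_ _ (succ_numbr s))]]]] := s'.
rewrite bet_ray_scalars ?(ltW lm) ?mm' ?(ltW lm') => [||//];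
  last exact: o_neq_a.
by case=> // /(ray_inj o_neq_a) e; move: lm; rewrite e ltxx.
Qed.

Lemma num_numb m p : num m p -> numb p.
Proof. by case: m => [->|m [q [_ /succ_numbr]]] //; exact: numb_a. Qed.

Lemma num_total m : exists p, num m p.
Proof.
elim: m => [|m [p mp]]; first by exists a.
have [_ [_ [/(_ _ (num_numb mp))[q pq] _]]] := om.
by exists q, p.
Qed.

Lemma num_fun m p p' : num m p -> num m p' -> p = p'.
Proof.
elim: m p p' => [|m IH] p p' /=; first by move=> -> ->.
by move=> [q [mq sq]] [q' [/(IH _ _ mq) <-]]; exact: succ_fun.
Qed.

Lemma num_lt k m l l' : (k < m)%N -> (0 <= l')%R ->
  num k (ray l) -> num m (ray l') -> (l < l')%R.
Proof.
elim: m l' => // m IH l'; rewrite ltnS leq_eqVlt => km l'0 kl [q [mq]].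
have /numb_ray[r r1 qE] := num_numb mq; subst q.
move=> /(succ_ray (le_trans ler01 r1))[m' rm' /(ray_inj o_neq_a) ?]; subst m'.
case/orP: km => [/eqP ?|km]; last first.
  by apply: lt_trans rm'; apply: IH => //; lra.
by subst m; move: rm'; rewrite (ray_inj o_neq_a (num_fun kl mq)).
Qed.

Lemma num_inj k m p : num k p -> num m p -> k = m.
Proof.
move=> kp mp; have /numb_ray[l l1 pE] := num_numb kp; subst p.
have l0 := le_trans ler01 l1.
case: (ltngtP k m) => // /num_lt/(_ l0).
  by move=> /(_ _ kp mp); rewrite ltxx.
by move=> /(_ _ mp kp); rewrite ltxx.
Qed.

Lemma num_le_iff k m p q : num k p -> num m q -> bt o p q <-> (k <= m)%N.
Proof.
move=> kp mq; have /numb_ray[l l1 pE] := num_numb kp.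
have /numb_ray[r r1 qE] := num_numb mq; subst p q.
have l0 := le_trans ler01 l1; have r0 := le_trans ler01 r1.
rewrite bet_o_ray //; case: (ltngtP k m) => [km|mk|e].
- by rewrite (ltW (num_lt km r0 kp mq)).
- by rewrite leNgt (num_lt mk l0 mq kp).
- by subst m; rewrite (ray_inj o_neq_a (num_fun kp mq)) lexx.
Qed.

Lemma succ_num k m p q : num k p -> num m q -> succ p q <-> m = k.+1.
Proof.
move=> kp mq; split=> [s|e].
  by apply: (num_inj mq); exists p.
by subst m; case: mq => p' [/(num_fun kp) <-].
Qed.

(* Otherwise the points [num k] are bounded, and their supremum would be an
   accumulation point. *)
Lemma numb_num p : numb p -> exists k, num k p.
Proof.
move=> np; apply: contrapT => nk; have [m m1 pE] := numb_ray np; subst p.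
have oa := o_neq_a.
pose S := [set l : R | (1 <= l)%R /\ exists k, num k (ray l)].
have S_next l : S l -> exists2 l', S l' & (l < l')%R.
  move=> [l1 [k kl]]; have [q kq] := num_total k.+1.
  have [p' [/(num_fun kl) <- s]] := kq.
  have [l' ll' qE] := succ_ray (le_trans ler01 l1) s; exists l' => //.
  by split; [exact: le_trans (ltW ll')|exists k.+1; rewrite -qE].
have S1 : S 1%R by split=> //; exists 0; rewrite /= ray1.
have S_ub l : S l -> (l <= m)%R.
  move=> [l1 [k]]; elim: k l l1 => [|k IH] l l1 /=.
    by rewrite -{2}(ray1 o a) => /(ray_inj oa) ->.
  move=> [q [kq]]; have /numb_ray[r r1 qE] := num_numb kq; subst q.
  have r0 := le_trans ler01 r1.
  move=> s; have [l' rl' /(ray_inj oa) ?] := succ_ray r0 s; subst l'.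
  (* If a successor step jumped over [p], then [p] would lie between consecutive numbers and hence
     be one of them: the first is some [num k], and the second lies beyond [p]. *)
  rewrite leNgt; apply/negP => ml.
  have [_ [_ [_ [_ /(_ _ np)]]]] := s.
  rewrite bet_ray_scalars ?(ltW rl') // (IH _ r1 kq) (ltW ml) => /(_ isT).
  case=> /(ray_inj oa) e; last by move: ml; rewrite e ltxx.
  by apply: nk; exists k; rewrite e.
have hsS : has_sup S by split; [exists 1%R|exists m => l /S_ub].
have S_sup l : S l -> (l <= sup S)%R by apply: sup_upper_bound.
have sup1 : (1 < sup S)%R.
  by have [l /S_sup lS l1] := S_next _ S1; apply: lt_le_trans lS.
(* No number lies strictly between [y] and the supremum. But [S] has elements above the coordinate
   of [y], and they are below the supremum since [S] has no greatest element. *)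
have [_ [_ [_ /(_ (ray (sup S)))]]] := om.
case=> [||y [+ [ynx yx]]].
- by apply/(bet_beyond _ oa); exists (sup S) => //; apply: ltW.
- by rewrite -{2}(ray1 o a) => /(ray_inj oa) e; move: sup1; rewrite e ltxx.
rewrite -{1}(ray1 o a) bet_ray ?(ltW sup1) // => -[r /andP[r1 rs] yE]; subst y.
have {}rs : (r < sup S)%R.
  by rewrite lt_neqAle rs andbT; apply: contra_not_neq ynx => ->.
have [l Sl rl] := sup_gt (ex_intro S _ S1) rs.
have [l' Sl' ll'] := S_next _ Sl.
have ls : (l < sup S)%R by apply: lt_le_trans ll' (S_sup _ Sl').
have nl : numb (ray l) by case: Sl => _ [k /num_numb].
have := yx _ nl; rewrite bet_ray_scalars ?(ltW rs) // (ltW rl) (ltW ls).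
case=> // /(ray_inj oa) e; first by move: rl; rewrite e ltxx.
by move: ls; rewrite {1}e ltxx.
Qed.

Hypothesis ax : recursion_axioms bt P o a b.

(** Induction on [j] along the recursion axioms; [numb_num] makes the witness [w] a standard number,
    to which the induction hypothesis applies. *)
Lemma add_num i j k x y z : num i x -> num j y -> num k z ->
  add bt P o a b x y z <-> k = i + j.
Proof.
have [ax0 [axS _]] := ax.
move=> ix jy; elim: j y jy k z => [|j IH] y /= jy k z kz.
  rewrite jy addn0 (ax0 _ _ (num_numb ix) (num_numb kz)).
  split=> [zx|ki]; first by apply: (num_inj kz); rewrite zx.
  by subst k; exact: num_fun kz ix.
have [y' [jy' s]] := jy.
rewrite (axS _ _ _ _ (num_numb ix) s (num_numb kz)); split=> [[w [xw wz]]|ke].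
  have [l lw] := numb_num (succ_numbl wz).
  by move: xw wz; rewrite (IH _ jy' _ _ lw) (succ_num lw kz) addnS => -> ->.
have [w ijw] := num_total (i + j); exists w.
by rewrite (IH _ jy' _ _ ijw) (succ_num ijw kz) ke addnS.
Qed.

Lemma mul_num i j k x y z : num i x -> num j y -> num k z ->
  mul bt P o a b x y z <-> k = i * j.
Proof.
have [_ [_ [ax0 axS]]] := ax.
move=> ix jy; elim: j y jy k z => [|j IH] y /= jy k z kz.
  rewrite jy muln0 (ax0 _ _ (num_numb ix) (num_numb kz)).
  split=> [za|k0]; last by subst k.
  by apply: (num_inj kz); rewrite za.
have [y' [jy' s]] := jy.
rewrite (axS _ _ _ _ (num_numb ix) s (num_numb kz)).
split=> [[w [nw [xw wz]]]|ke].
  have [l lw] := numb_num nw.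
  move: xw wz; rewrite (IH _ jy' _ _ lw) (add_num lw ix kz) mulnS addnC.
  by move=> -> ->.
have [w ijw] := num_total (i * j); exists w; split; first exact: num_numb ijw.
by rewrite (IH _ jy' _ _ ijw) (add_num ijw ix kz) ke mulnS addnC.
Qed.

Lemma tval_num e (ev : nat -> nat) t z : (forall i, num (ev i) (e i)) ->
  tval bt P o a b e t z <-> num (term_val ev t) z.
Proof.
move=> He.
have op (f : nat -> nat -> nat) g t1 t2
    (IH1 : forall z, tval bt P o a b e t1 z <-> num (term_val ev t1) z)
    (IH2 : forall z, tval bt P o a b e t2 z <-> num (term_val ev t2) z)
    (Hg : forall i j k x y z, num i x -> num j y -> num k z ->
       g x y z <-> k = f i j) z' :
  numb z' /\ (exists x y, tval bt P o a b e t1 x /\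
     tval bt P o a b e t2 y /\ g x y z') <->
  num (f (term_val ev t1) (term_val ev t2)) z'.
  split=> [[/numb_num[k kz] [x [y [/IH1 tx [/IH2 uy]]]]]|].
    by rewrite (Hg _ _ _ _ _ _ tx uy kz) => <-.
  move=> kz; split; first exact: num_numb kz.
  have [x tx] := num_total (term_val ev t1).
  have [y uy] := num_total (term_val ev t2).
  by exists x, y; rewrite IH1 IH2 (Hg _ _ _ _ _ _ tx uy kz).
elim: t z => [i|||t IHt u IHu|t IHt u IHu] z.
- by split=> /= [->//|zx]; exact: num_fun zx (He _).
- by [].
- by split=> /= [s|[q [->]]] //; exists a.
- exact: (op addn _ _ _ IHt IHu add_num).
- exact: (op muln _ _ _ IHt IHu mul_num).
Qed.

Definition decoded_sets (k : nat) : set nat :=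
  [set m | exists p, num m p /\ member bt P o a b k p].

(** Numbers of the code correspond one to one to natural numbers, by [num_total], [num_fun],
    [num_inj] and [numb_num]. So the translation is faithful for every [P] obeying the axioms,
    whatever sets it codes. *)
Lemma trans_sat phi e (ev : nat -> nat) : (forall i, num (ev i) (e i)) ->
  trans bt P o a b e phi <-> sat (arith_holds decoded_sets) ev phi.
Proof.
elim: phi e ev => [[t u|t u|t k]|p IH|p IHp q IHq|x p IH] e ev He /=.
- have tv t' := tval_num t' _ He; split=> [[x []]|tu].
    by rewrite !tv; exact: num_inj.
  have [x tx] := num_total (term_val ev t).
  by exists x; rewrite !tv -tu.
- have tv t' := tval_num t' _ He; split=> [[x [y []]]|tu].
    rewrite !tv => tx [uy [ne]]; rewrite (num_le_iff tx uy) leq_eqVlt.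
    case/orP=> // /eqP e'; case: ne; apply: num_fun tx _.
    by rewrite e'.
  have [x tx] := num_total (term_val ev t).
  have [y uy] := num_total (term_val ev u).
  exists x, y; rewrite !tv (num_le_iff tx uy) (ltnW tu); do !split => //.
  by move=> xy; move: uy tu; rewrite -xy => /(num_inj tx) ->; rewrite ltnn.
- have tv t' := tval_num t' _ He; split=> [[x [/tv tx m]]|[p [tx m]]].
    by exists x.
  by exists p; rewrite tv.
- by rewrite (IH _ ev).
- by rewrite (IHp _ ev) // (IHq _ ev).
- have up d m : num m d -> forall i, num (upd ev x m i) (upd e x d i).
    by move=> md i; rewrite /upd; case: eqP.
  split=> [[d [/numb_num[m md]]]|[m]].
    by rewrite (IH _ _ (up _ _ md)); exists m.
  have [d md] := num_total m; rewrite -(IH _ _ (up _ _ md)) => h.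
  by exists d; split=> //; apply: num_numb md.
Qed.

End Numbers.

(** * Existence of codes *)

Section PowersOfTwo.
Variable R : realType.
Local Notation pow i := (2%:R ^+ i : R)%R.

Lemma pow_ge1 i : (1 <= pow i)%R. Proof. by rewrite exprn_ege1 // ler1n. Qed.

Lemma pow_gt0 i : (0 < pow i)%R. Proof. by rewrite exprn_gt0. Qed.

Lemma pow_le i j : (pow i <= pow j)%R = (i <= j)%N.
Proof. by rewrite ler_eXn2l // ltr1n. Qed.

Lemma pow_inj i j : pow i = pow j -> i = j.
Proof. by move=> e; apply/eqP; rewrite eqn_leq -!pow_le e lexx. Qed.

End PowersOfTwo.

(** * Rays whose points in [P] are the powers of two *)

Section DyadicAxis.
Variables (R : realType) (n : nat) (P : set 'rV[R]_n) (o a : 'rV[R]_n).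
Local Notation bt := (@eucl_bet R n).
Local Notation pow i := (2%:R ^+ i : R)%R.
Hypothesis oa : o <> a.
Hypothesis P_ray : forall l : R, (1 <= l)%R ->
  P (ray o a l) <-> exists i, l = pow i.

Lemma dyadic_numb p : numb bt P o a p <-> exists i, p = ray o a (pow i).
Proof.
split=> [[Pp /(bet_beyond _ oa)[l l1 pE]]|[i ->]].
  by move: Pp; rewrite pE P_ray // => -[i ->]; exists i.
split; first by apply/P_ray; [exact: pow_ge1|exists i].
by apply/(bet_beyond _ oa); exists (pow i) => //; exact: pow_ge1.
Qed.

Lemma dyadic_bet i j k : (i <= k)%N ->
  bt (ray o a (pow i)) (ray o a (pow j)) (ray o a (pow k)) <-> (i <= j <= k)%N.
Proof. by move=> ik; rewrite bet_ray_scalars ?pow_le. Qed.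

Lemma dyadic_succ i j :
  succ bt P o a (ray o a (pow i)) (ray o a (pow j)) <-> j = i.+1.
Proof.
have nb k : numb bt P o a (ray o a (pow k)) by apply/dyadic_numb; exists k.
have ij_le k m : bt o (ray o a (pow k)) (ray o a (pow m)) <-> (k <= m)%N.
  rewrite -{1}(ray0 o a) bet_ray_scalars ?(ltW (pow_gt0 R _)) //.
  by rewrite pow_le.
split=> [[_ [_ [ne [/ij_le ij H]]]]|->].
  have lt : (i < j)%N.
    by rewrite ltn_neqAle ij andbT; apply: contra_not_neq ne => ->.
  have := H _ (nb i.+1); rewrite dyadic_bet // leqnSn lt => /(_ isT).
  by case=> /(ray_inj oa)/pow_inj => [/eqP|->//]; rewrite gtn_eqF.
do ![split=> //]; first by move=> /(ray_inj oa)/pow_inj/eqP; rewrite ltn_eqF.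
  exact/ij_le.
move=> r /dyadic_numb[k ->]; rewrite dyadic_bet // => /andP[ik].
rewrite leq_eqVlt => /orP[/eqP ->|ki]; first by right.
by left; congr (ray o a (pow _)); lia.
Qed.

Lemma dyadic_omega_type : omega_type bt P o a.
Proof.
have Pa : P a by rewrite -(ray1 o a) P_ray //; exists 0; rewrite expr0.
do ![split=> //].
  move=> p /dyadic_numb[i ->]; exists (ray o a (pow i.+1)).
  exact/dyadic_succ.
move=> x /(bet_beyond _ oa)[l l1 ->] la.
have {}l1 : (1 < l)%R.
  by rewrite lt_neqAle l1 andbT; apply: contra_not_neq la => <-; rewrite ray1.
have ex_i : exists i, (l <= pow i)%R.
  have [k lk] : exists k, (l <= k%:R)%R.
    by exists (Num.bound l); apply/ltW/archi_boundP/ltW/(lt_trans ltr01).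
  by exists k; apply: le_trans lk _; rewrite -natrX ler_nat ltnW // ltn_expl.
(* Below the least power of two that is at least [l], the preceding power serves as [y]: any later
   power up to [l] equals [l]. Exponent 0 is excluded by [1 < l]. *)
case: (ex_minnP ex_i) => -[|i] li imin; first by move: l1; rewrite ltNge li.
have il : (pow i < l)%R.
  by rewrite ltNge; apply/negP => /imin; rewrite ltnn.
exists (ray o a (pow i)); split; last split.
- rewrite -{1}(ray1 o a) bet_ray ?(ltW l1) //; exists (pow i) => //.
  by rewrite pow_ge1 ltW.
- by move=> /(ray_inj oa) e; move: il; rewrite e ltxx.
move=> r /dyadic_numb[k ->]; rewrite bet_ray_scalars ?(ltW il) //.
rewrite pow_le => /andP[]; rewrite leq_eqVlt => /orP[/eqP ->|ik kl].
  by left.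
right; congr ray; apply/eqP; rewrite eq_le kl (le_trans li) //.
by rewrite pow_le.
Qed.

Lemma dyadic_num m p : num bt P o a m p <-> p = ray o a (pow m).
Proof.
elim: m p => [|m IH] p /=; first by rewrite expr0 ray1.
split=> [[q [/IH -> s]]|->].
  have /dyadic_numb[k pE] := succ_numbr s.
  by move: s; rewrite pE => /dyadic_succ ->.
by exists (ray o a (pow m)); rewrite IH dyadic_succ.
Qed.

End DyadicAxis.

(** * A planar configuration with prescribed rows *)

Section Grid.
Variables (R : realType) (n : nat) (i0 i1 : 'I_n).
Hypothesis i01 : i0 != i1.
Variable W : nat -> set nat.
Local Notation bt := (@eucl_bet R n).
Local Notation pow i := (2%:R ^+ i : R)%R.

(** Two distinct coordinates span the plane of the code; dimension at least two enters here. *)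
Definition pt (x y : R) : 'rV[R]_n :=
  (x *: delta_mx ord0 i0 + y *: delta_mx ord0 i1)%R.

Lemma pt_inj x y x' y' : pt x y = pt x' y' -> x = x' /\ y = y'.
Proof.
move=> e; have c i := congr1 (fun p : 'rV[R]_n => p ord0 i) e.
move: (c i0) (c i1); rewrite !mxE !eqxx /= [i1 == _]eq_sym (negPf i01).
by rewrite !mulr1 !mulr0 !addr0 !add0r.
Qed.

Lemma ray_pt x y x' y' l :
  ray (pt x y) (pt x' y') l = pt (x + l * (x' - x)) (y + l * (y' - y)).
Proof.
rewrite /ray /pt opprD addrACA -!scalerBl scalerDr !scalerA addrACA.
by rewrite -!scalerDl.
Qed.

Local Notation o := (pt 0 0).
Local Notation a := (pt 1 0).
Local Notation b := (pt 0 1).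

(* As x + y = 2 has no solution in powers of two other than x = y = 1, a midpoint
   below lies on no other segment between points of the two axes. *)
Definition grid : set 'rV[R]_n :=
  [set p | (exists i, p = pt (pow i) 0) \/ (exists j, p = pt 0 (pow j)) \/
    exists i j, W j i /\ p = pt (pow i / 2) (pow j / 2)].

Lemma ray_oa l : ray o a l = pt l 0.
Proof. by rewrite ray_pt; congr pt; ring. Qed.

Lemma ray_ob l : ray o b l = pt 0 l.
Proof. by rewrite ray_pt; congr pt; ring. Qed.

Lemma oa_neq : o <> a.
Proof. by move=> /pt_inj[/eqP]; rewrite eq_sym oner_eq0. Qed.

Lemma ob_neq : o <> b.
Proof. by move=> /pt_inj[_ /eqP]; rewrite eq_sym oner_eq0. Qed.

(** Midpoints thus have no zero coordinate and add no point to either axis. *)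
Lemma half_pow_neq0 i : (pow i / 2 != 0)%R.
Proof. by rewrite gt_eqF // divr_gt0 ?pow_gt0. Qed.

Lemma grid_oa l : (1 <= l)%R -> grid (ray o a l) <-> exists i, l = pow i.
Proof.
rewrite ray_oa => l1; split=> [[[i /pt_inj[->]]|[[j /pt_inj[l0]]|]]|[i ->]].
- by exists i.
- by move: l1; rewrite l0 ler10.
- move=> [i [j [_ /pt_inj[_ /eqP]]]].
  by rewrite eq_sym (negPf (half_pow_neq0 _)).
- by left; exists i.
Qed.

Lemma grid_ob l : (1 <= l)%R -> grid (ray o b l) <-> exists j, l = pow j.
Proof.
rewrite ray_ob => l1; split=> [[[i /pt_inj[_ l0]]|[[j /pt_inj[_ ->]]|]]|[j ->]].
- by move: l1; rewrite l0 ler10.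
- by exists j.
- move=> [i [j [_ /pt_inj[/eqP + _]]]].
  by rewrite eq_sym (negPf (half_pow_neq0 _)).
- by right; left; exists j.
Qed.

(** A point strictly inside the segment is off the axes, so in [grid] it is a midpoint, with
    [l * 2 ^ i = 2 ^ i' / 2] and [(1 - l) * 2 ^ j = 2 ^ j' / 2]. Comparing exponents, [l] and
    [1 - l] are both at most one half, so it is the midpoint of this very segment. *)
Lemma grid_linked i j : linked bt grid (pt 0 (pow j)) (pt (pow i) 0) <-> W j i.
Proof.
have pp := @pow_gt0 R; split=> [[c [gc [cj [ci]]]]|Wji]; last first.
  exists (pt (pow i / 2) (pow j / 2)).
  split; first by right; right; exists i, j.
  split; first by move=> /pt_inj[/eqP]; rewrite (negPf (half_pow_neq0 _)).
  split; first by move=> /pt_inj[_ /eqP]; rewrite (negPf (half_pow_neq0 _)).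
  apply/eucl_betP; exists (1 / 2)%R; first by apply/andP; split; lra.
  by rewrite -[RHS]/(ray _ _ _) ray_pt; congr pt; field.
move=> /eucl_betP[l /andP[l0 l1]]; rewrite -[RHS]/(ray _ _ _) ray_pt => cE.
subst c; have pi := pp i; have pj := pp j.
have {}l0 : (0 < l)%R.
  rewrite lt_neqAle l0 andbT; apply: contra_not_neq cj => <-.
  by congr pt; ring.
have {}l1 : (l < 1)%R.
  rewrite lt_neqAle l1 andbT; apply: contra_not_neq ci => ->.
  by congr pt; ring.
move: gc {ci cj} => -[[k /pt_inj[_ e]]|[[k /pt_inj[e _]]|[i' [j' [W']]]]].
- by exfalso; nra.
- by exfalso; nra.
move=> /pt_inj[ei ej].
(* Indeed [2 ^ k' = 2 * x * 2 ^ k] is less than [2 ^ k.+1]. *)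
have ltpow k k' (x : R) : (0 < x)%R -> (x < 1)%R ->
    (x * pow k = pow k' / 2)%R -> (pow k' <= pow k)%R.
  move=> x0 x1 e; have pk := pp k.
  rewrite pow_le -ltnS ltnNge -(pow_le R) exprS; apply/negP => h; nra.
have hi : (pow i' <= pow i)%R by apply: (ltpow _ _ l) => //; lra.
have hj : (pow j' <= pow j)%R by apply: (ltpow _ _ (1 - l)%R); lra.
have l2 : (l = 1 / 2)%R.
  apply/eqP; rewrite eq_le; apply/andP; split; first by nra.
  by nra.
have -> : i = i' by apply: (@pow_inj R); move: ei; rewrite l2; lra.
have -> : j = j' by apply: (@pow_inj R); move: ej; rewrite l2; lra.
by [].
Qed.

Lemma grid_numb p : numb bt grid o a p <-> exists i, p = pt (pow i) 0.
Proof.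
rewrite (dyadic_numb oa_neq grid_oa).
by split=> -[i ->]; exists i; rewrite ray_oa.
Qed.

Lemma grid_num m p : num bt grid o a m p <-> p = pt (pow m) 0.
Proof. by rewrite (dyadic_num oa_neq grid_oa) ray_oa. Qed.

Lemma grid_succ i j :
  succ bt grid o a (pt (pow i) 0) (pt (pow j) 0) <-> j = i.+1.
Proof.
rewrite -(ray_oa (pow i)) -(ray_oa (pow j)).
exact: (dyadic_succ oa_neq grid_oa).
Qed.

Lemma grid_succ_rows t t' : succ bt grid o b t t' <->
  exists j, t = pt 0 (pow j) /\ t' = pt 0 (pow j.+1).
Proof.
split=> [s|[j [-> ->]]]; last first.
  rewrite -(ray_ob (pow j)) -(ray_ob (pow j.+1)).
  exact/(dyadic_succ ob_neq grid_ob).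
have /(dyadic_numb ob_neq grid_ob)[j tE] := succ_numbl s.
have /(dyadic_numb ob_neq grid_ob)[j' tE'] := succ_numbr s.
move: s; rewrite tE tE' (dyadic_succ ob_neq grid_ob) => ->.
by exists j; rewrite !ray_ob.
Qed.

Lemma grid_coded i j k l :
  coded bt grid o a b (pt (pow i) 0) (pt (pow j) 0) (pt (pow k) 0)
    (pt (pow l) 0) <->
  exists r, (forall x, ~ W r x) /\ W r.+1 i /\ W r.+2 j /\ W r.+3 k /\ W r.+4 l.
Proof.
split=> [|[r [W0 [Wi [Wj [Wk Wl]]]]]]; last first.
  exists (pt 0 (pow r)), (pt 0 (pow r.+1)), (pt 0 (pow r.+2)),
    (pt 0 (pow r.+3)), (pt 0 (pow r.+4)).
  do 4 (split; first by apply/grid_succ_rows; eexists; split).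
  split; first by move=> p /grid_numb[m ->]; rewrite grid_linked.
  by rewrite !grid_linked.
(* A row is determined by its point, so the four successor conditions chain into five consecutive
   rows. *)
have rI r r' : pt 0 (pow r) = pt 0 (pow r') -> r = r'.
  by move=> /pt_inj[_ /pow_inj].
move=> [t0 [t1 [t2 [t3 [t4 []]]]]].
move=> /grid_succ_rows[r [-> ->]] [/grid_succ_rows[r1 [/rI <- ->]]].
move=> [/grid_succ_rows[r2 [/rI <- ->]] [/grid_succ_rows[r3 [/rI <- ->]]]].
move=> [H]; rewrite !grid_linked => h; exists r; split=> // x.
by rewrite -grid_linked; apply: H; apply/grid_numb; exists x.
Qed.

Variable Q : nat -> nat -> nat -> nat -> Prop.
Hypothesis W_Q : forall i j k l,
  (exists r, (forall x, ~ W r x) /\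
     W r.+1 i /\ W r.+2 j /\ W r.+3 k /\ W r.+4 l) <-> Q i j k l.

Lemma grid_add i j k :
  add bt grid o a b (pt (pow i) 0) (pt (pow j) 0) (pt (pow k) 0) <-> Q 0 i j k.
Proof. by rewrite -W_Q -grid_coded /add expr0. Qed.

Lemma grid_mul i j k :
  mul bt grid o a b (pt (pow i) 0) (pt (pow j) 0) (pt (pow k) 0) <-> Q 1 i j k.
Proof.
rewrite -W_Q -grid_coded /mul.
have succ_a m : succ bt grid o a a (pt (pow m) 0) <-> m = 1.
  by have := grid_succ 0 m; rewrite expr0.
split=> [[t [s]]|c]; last first.
  by exists (pt (pow 1) 0); split=> //; apply/succ_a.
have /grid_numb[m tE] := succ_numbr s; subst t.
by move: s; rewrite succ_a => ->.
Qed.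

Lemma grid_codes_arith :
  (forall i j k, Q 0 i j k <-> k = i + j) ->
  (forall i j k, Q 1 i j k <-> k = i * j) ->
  codes_arith bt grid o a b.
Proof.
move=> Q0 Q1; have numP := grid_numb.
split; first exact: (dyadic_omega_type oa_neq grid_oa).
have ptE i j : pt (pow i) 0 = pt (pow j) 0 <-> i = j.
  by split=> [/pt_inj[/pow_inj]|->].
have succP y y' : succ bt grid o a y y' ->
    exists j, y = pt (pow j) 0 /\ y' = pt (pow j.+1) 0.
    move=> s.
    have /numP[j yE] := succ_numbl s; have /numP[j' yE'] := succ_numbr s.
    by move: s; rewrite yE yE' => /grid_succ ->; exists j.
split; last split; last split.
- move=> x z /numP[i ->] /numP[k ->].
  (* Zero is the point [a], whose coordinate is [2 ^ 0]. *)
  by have := grid_add i 0 k; rewrite expr0 => ->; rewrite Q0 ptE addn0.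
- move=> x y y' z /numP[i ->] /succP[j [-> ->]] /numP[k ->].
  rewrite grid_add Q0; split=> [->|[w [+ s]]].
    by exists (pt (pow (i + j)) 0); rewrite grid_add Q0 grid_succ addnS.
  have /numP[m wE] := succ_numbl s; move: s; rewrite wE grid_succ grid_add Q0.
  by move=> -> ->; rewrite addnS.
- move=> x z /numP[i ->] /numP[k ->].
  have := grid_mul i 0 k; rewrite expr0 => ->; rewrite Q1 muln0 -(ptE k 0).
  by rewrite expr0.
- move=> x y y' z /numP[i ->] /succP[j [-> ->]] /numP[k ->].
  rewrite grid_mul Q1; split=> [->|[w [/numP[m ->]]]].
    exists (pt (pow (i * j)) 0); rewrite numP grid_mul Q1 grid_add Q0.
    by rewrite mulnS addnC; do !split=> //; exists (i * j).
  by rewrite grid_mul grid_add Q1 Q0 mulnS addnC => -[-> ->].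
Qed.

Lemma grid_decoded_sets (X : nat -> set nat) :
  (forall k x, Q k.+2 x x x <-> X k x) -> decoded_sets grid o a b = X.
Proof.
move=> QX; apply: funext => k; apply/seteqP; split=> x /=; rewrite -QX -W_Q.
  by move=> [p [/grid_num -> [t [/grid_num -> /grid_coded]]]].
move=> c; exists (pt (pow x) 0); split; first exact/grid_num.
by exists (pt (pow k.+2) 0); rewrite grid_num grid_coded.
Qed.

End Grid.

(** * Rows for a quaternary relation *)

Section Quadruples.
Variable Q : nat -> nat -> nat -> nat -> Prop.

(* Row 5q is empty and rows 5q+1 to 5q+4 are singletons if q codes a quadruple
   in Q; otherwise these five rows are full. *)
Definition rows (r : nat) : set nat :=
  if (unpickle (r %/ 5) : option (nat * nat * nat * nat)) is Some (i, j, k, l)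
  then [set x | Q i j k l ->
         (0 < r %% 5)%N /\ x = nth 0 [:: 0; i; j; k; l] (r %% 5)]
  else setT.

(** Empty rows act as markers: a row other than the first of a block is full or a singleton, and a
    first row is empty only if its block codes a quadruple in [Q]. So whatever is read after an
    empty row is a whole block. *)
Lemma rows_quadruples i j k l :
  (exists r, (forall x, ~ rows r x) /\
    rows r.+1 i /\ rows r.+2 j /\ rows r.+3 k /\ rows r.+4 l) <-> Q i j k l.
Proof.
have blk q m : (m < 5)%N -> (5 * q + m) %/ 5 = q /\ (5 * q + m) %% 5 = m.
  by move=> m5; split; lia.
have rowE q m : (m < 5)%N -> forall x, rows (5 * q + m) x <->
    if (unpickle q : option (nat * nat * nat * nat)) is Some (i, j, k, l)
    then Q i j k l -> (0 < m)%N /\ x = nth 0 [:: 0; i; j; k; l] m else True.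
  move=> /(blk q)[e1 e2] x; rewrite /rows e1 e2.
  by case: unpickle => [[[[? ?] ?] ?]|].
split=> [[r [r0]]|q].
  have rE : r = 5 * (r %/ 5) + r %% 5 by lia.
  have m5 : (r %% 5 < 5)%N by rewrite ltn_mod.
  move: (r %/ 5) (r %% 5) rE m5 r0 => q m -> {r} m5 r0.
  case uq : (unpickle q : option (nat * nat * nat * nat))
    => [[[[i' j'] k'] l']|]; last by case: (r0 0); apply/rowE => //; rewrite uq.
  have Qq : Q i' j' k' l'.
    by apply: contrapT => nQ; case: (r0 0); apply/rowE => //; rewrite uq.
  have m0 : m = 0.
    case: m m5 r0 => // m m5 r0; case: (r0 (nth 0 [:: 0; i'; j'; k'; l'] m.+1)).
    by apply/rowE => //; rewrite uq.
  rewrite m0 -!addnS !rowE // uq /=.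
  by move=> [/(_ Qq)[_ ->] [/(_ Qq)[_ ->] [/(_ Qq)[_ ->] /(_ Qq)[_ ->]]]].
exists (5 * pickle (i, j, k, l) + 0); split=> [x|].
  by rewrite rowE // pickleK => /(_ q)[].
by rewrite -!addnS !rowE // pickleK.
Qed.

End Quadruples.

(** * The reduction *)

(** A formula obtained from [def_num] would depend on [m] in an uncontrolled way. Here [m] only
    counts iterations of one construction: the inner quantifier rebinds variable 3 to the value of
    variable 4, so no new variables are needed. *)
Fixpoint num_form (sf : fo_form geo_atom) (m : nat) : fo_form geo_atom :=
  if m is m'.+1
  then Ex 4 (And (Ex 3 (And (Atom (GEq 3 4)) (num_form sf m'))) sf)
  else Atom (GEq 3 1).

Lemma sat_num_form (D : Type) (bt : D -> D -> D -> Prop) P sf :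
  (forall s, sat (@geo_holds (GeoStruct bt P)) s sf <->
     succ bt P (s 0) (s 1) (s 4) (s 3)) ->
  forall m s, sat (@geo_holds (GeoStruct bt P)) s (num_form sf m) <->
    num bt P (s 0) (s 1) m (s 3).
Proof.
move=> Hsf; elim=> [//|m IH] s /=; split.
  move=> [d [[d' [e /IH h]] /Hsf s4]]; exists d; split=> //.
  by move: h e; rewrite /upd /= => + <-.
move=> [q [mq s4]]; exists q; split; last exact/Hsf.
by exists q; split=> //; apply/IH.
Qed.

(** The bound does not depend on [m], so one closure prefix serves all inputs. *)
Lemma fv_num_form sf m :
  {subset fv geo_vars (num_form sf m) <= [:: 1, 3, 4 & fv geo_vars sf]}.
Proof.
elim: m => [|m IH] x /=; first by rewrite !inE => /orP[]/eqP ->.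
rewrite mem_filter mem_cat mem_filter => /andP[_ /orP[/andP[_ /IH]|xs]] //.
by rewrite !inE xs !orbT.
Qed.

Definition hard_sentence (l : seq nat) (gf sf tf : fo_form geo_atom) (m : nat) :
    fo_form geo_atom :=
  all_closure l (Neg (And (And gf (num_form sf m)) (Neg tf))).

Lemma hard_sentence_sentence gf sf tf m :
  sentence (hard_sentence
    ([:: 1, 3, 4 & fv geo_vars sf] ++ fv geo_vars gf ++ fv geo_vars tf)
    gf sf tf m).
Proof.
rewrite /sentence fv_all_closure; apply/eqP.
rewrite -(negbK (_ == _)) -has_filter.
apply/negP => /hasP[x x_in /negP]; apply; move: x_in.
rewrite -[fv _ _]/((fv _ gf ++ fv _ (num_form sf m)) ++ fv _ tf).
by rewrite !mem_cat => /orP[/orP[->|/fv_num_form ->]|->]; rewrite ?orbT.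
Qed.

Lemma computes_num_form sf :
  computes (fun v : 1.-tuple nat => godel (num_form sf (thead v))).
Proof.
(* One step of [num_form] on Gödel numbers, to be iterated: 5 is the tag of [Ex], followed by the
   bound variable 4 or 3, and the remaining 4s are tags of [And]. *)
pose F g := cpair 5 (cpair 4 (cpair 4 (cpair
  (cpair 5 (cpair 3 (cpair 4 (cpair (godel (Atom (GEq 3 4))) g))))
  (godel sf)))).
have cF : computes (fun v : 1.-tuple nat => F (thead v)).
  do ![apply: computes_cpair; try exact: computes_cst].
  exact: computes_proj.
apply: computes_ext (computes_iter (godel (Atom (GEq 3 1))) cF) => v.
by elim: (thead v) => //= m ->.
Qed.

Lemma computable_hard_sentence l gf sf tf :
  computable (fun m => godel (hard_sentence l gf sf tf m)).
Proof.
apply: computable_computes; rewrite /hard_sentence.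
elim: l => [|x l IH] /=; last first.
  by do ![apply: computes_cpair; try exact: computes_cst].
do ![apply: computes_cpair; try exact: computes_cst].
exact: computes_num_form.
Qed.

Theorem theorem4p16 (R : realType) (n : nat) (hn : (2 <= n)%N) :
  Pi11_hard (godel @` fo_theory (unary_expansion_class R n)).
Proof.
move=> A [phi _ A_phi]; pose bt := @eucl_bet R n.
(* Variables 0, 1, 2 hold [o], [a], [b], variable 3 holds the input, and variable 4 is auxiliary in
   [num_form]. *)
have [gf Hg] := def_codes_arith bt 0 1 2.
have [sf Hs] := def_succ bt 0 1 4 3.
(* All number variables of [phi] start at the value of variable 3, as [Pi11] evaluates [phi] under a
   constant assignment. *)
have [tf Ht] := def_trans bt phi 0 1 2 (fun=> 3).
pose chi := hard_sentence
  ([:: 1, 3, 4 & fv geo_vars sf] ++ fv geo_vars gf ++ fv geo_vars tf) gf sf tf.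
have chiP m P : models (GeoStruct bt P) (chi m) <->
    forall s : nat -> 'rV[R]_n, codes_arith bt P (s 0) (s 1) (s 2) ->
      num bt P (s 0) (s 1) m (s 3) ->
      trans bt P (s 0) (s 1) (s 2) (fun=> s 3) phi.
  rewrite /models /chi /hard_sentence sat_all_closure /=.
  split=> H s; last first.
    move=> [[/Hg g /(sat_num_form (Hs P)) ms]]; apply.
    by apply/Ht; exact: H g ms.
  move=> g ms; apply/(Ht P s); apply: contrapT => nt; apply: (H s); split=> //.
  by split; [apply/Hg|apply/(sat_num_form (Hs P))].
exists (fun m => godel (chi m)); first exact: computable_hard_sentence.
move=> m; rewrite A_phi; split=> [Hphi|[psi + /godel_inj e] X].
  exists (chi m) => //; split; first exact: hard_sentence_sentence.
  (* A [P] that codes arithmetic decodes to some sets, and [phi] holds for all sets; for any other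
     [P] the implication is vacuous. *)
  move=> M [P ->]; apply/chiP => s [om ax] ms.
  by rewrite (trans_sat om ax phi (ev := fun=> m)).
rewrite e => -[_ mod]; pose i0 := Ordinal (ltnW hn); pose i1 := Ordinal hn.
have i01 : i0 != i1 by [].
(* Conversely, tags 0 and 1 carry the true sum and product and the later tags the given sets, so
   that the resulting [P] decodes to exactly [X]. *)
pose Q t i j k := match t with
  | 0 => k = i + j | 1 => k = i * j | t'.+2 => X t' i end.
pose W := rows Q; pose P := @grid R n i0 i1 W.
have W_Q := rows_quadruples Q.
pose p x y : 'rV[R]_n := @pt R n i0 i1 x y.
have coding : codes_arith bt P (p 0 0)%R (p 1 0)%R (p 0 1)%R.
  exact: (grid_codes_arith R i01 W_Q).
have decoded : decoded_sets P (p 0 0)%R (p 1 0)%R (p 0 1)%R = X.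
  exact: (@grid_decoded_sets R n i0 i1 i01 W Q W_Q).
have m_num : num bt P (p 0 0)%R (p 1 0)%R m (p (2%:R ^+ m) 0)%R.
  exact/(@grid_num R n i0 i1 i01).
rewrite -decoded.
apply/(@trans_sat _ _ _ _ _ _ coding.1 coding.2 _
  (fun=> p (2%:R ^+ m) 0)%R) => //.
have /chiP H : models (GeoStruct bt P) (chi m) by apply: mod; exists P.
(* The default value of [nth] is the point coding [m], which thereby becomes the value of variable
   3. *)
exact: (H (nth (p (2%:R ^+ m) 0)%R [:: p 0 0; p 1 0; p 0 1]%R)).
Qed.
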